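(* Let $\mathcal{H}$ be a hypergraph without isolated vertices. Then $\mathcal{L}(\mathcal{H})$ is connected if and only if $\mathcal{H}$ is connected.
   Context: A hypergraph $\mathcal{H}=(V,E)$ consists of a finite set $V$ of vertices and a set $E$ of non-empty subsets of $V$, called hyperedges. Hypergraphs are assumed simple: no hyperedge has cardinality one and no hyperedge is contained in another. (Connectedness is not assumed here.) A vertex is isolated if it belongs to no hyperedge. The line multigraph $\mathcal{L}(\mathcal{H})$ is the multigraph with vertex set $E$ in which two distinct vertices $e,f\in E$ are joined by exactly $|e\cap f|$ edges (no loops). In a multigraph or hypergraph, a path is an alternating sequence of distinct vertices and (hyper)edges such that each (hyper)edge contains the vertices immediately preceding and following it in the sequence. A hypergraph or multigraph is connected if there is a path between every pair of vertices. *)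

(* Defs.v *)
From mathcomp Require Import all_boot.

Set Implicit Arguments.
Unset Strict Implicit.
Unset Printing Implicit Defensive.

Record hypergraph := Hypergraph {
  hvert : finType;
  hedges : {set {set hvert}};
  hedges_neq0 : set0 \notin hedges
}.

Definition hedge (H : hypergraph) := {e : {set hvert H} | e \in hedges H}.

Definition simple (H : hypergraph) : Prop :=
  (forall e, e \in hedges H -> #|e| != 1) /\
  (forall e f, e \in hedges H -> f \in hedges H -> e \subset f -> e = f).

Definition isolated (H : hypergraph) (v : hvert H) : Prop :=
  forall e, e \in hedges H -> v \notin e.

(* An edge with a single end is a loop; parallel edges are distinct elements
   of [medge] with the same set of ends. *)
Record multigraph := Multigraph {
  mvert : finType;
  medge : finType;
  mends : medge -> {set mvert};
  card_mends : forall a, 0 < #|mends a| <= 2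
}.

Definition edges_joining (G : multigraph) (u v : mvert G) : {set medge G} :=
  [set a | mends a == [set u; v]].

Section Paths.

(* [ends a] is the set of vertices contained in the (hyper)edge [a]; the
   sequence x, e1, v1, ..., ek, vk is represented by its first vertex [x] and
   the list [p] of pairs (e1, v1), ..., (ek, vk). *)
Variables (V E : finType) (ends : E -> {set V}).

Fixpoint alternating (x : V) (p : seq (E * V)) : bool :=
  if p is (a, y) :: p' then
    [&& x \in ends a, y \in ends a & alternating y p']
  else true.

Definition is_path (x y : V) (p : seq (E * V)) : bool :=
  [&& alternating x p, last x (unzip2 p) == y,
      uniq (x :: unzip2 p) & uniq (unzip1 p)].

Definition connected_by : Prop := forall x y : V, exists p, is_path x y p.

End Paths.

Definition hconnected (H : hypergraph) : Prop :=
  connected_by (fun e : hedge H => val e).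

Definition mconnected (G : multigraph) : Prop := connected_by (@mends G).

Section LineMultigraph.

Variable H : hypergraph.

(* The edges joining e and f are the pairs ({e, f}, v) with v in e and f. *)
Definition line_edge :=
  {a : {set hedge H} * hvert H |
    (#|a.1| == 2) && [forall e in a.1, a.2 \in val e]}.

Definition line_ends (a : line_edge) : {set hedge H} := (val a).1.

Lemma card_line_ends a : #|line_ends a| = 2.
Proof. by case/andP: (valP a) => /eqP. Qed.

Lemma line_ends_bound a : 0 < #|line_ends a| <= 2.
Proof. by rewrite card_line_ends. Qed.

Definition line_multigraph : multigraph := Multigraph line_ends_bound.

Lemma card_edges_joining_line (e f : mvert line_multigraph) : e != f ->
  #|edges_joining e f| = #|val e :&: val f|.
Proof.
move=> nef.
rewrite -(card_in_imset (f := fun a : medge line_multigraph => (val a).2)).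
  apply: eq_card => v; rewrite inE; apply/imsetP/andP.
    case=> a; rewrite inE => /eqP Ea ->.
    case/andP: (valP a) => _ /forall_inP hv.
    by split; apply: hv; rewrite -/(line_ends a) [line_ends a]Ea !inE eqxx ?orbT.
  case=> ve vf.
  have Pa : (#|([set e; f], v).1| == 2) &&
      [forall g in ([set e; f], v).1, ([set e; f], v).2 \in val g].
    rewrite /= cards2 nef /=; apply/forall_inP => g.
    by rewrite !inE => /orP[] /eqP ->.
  by exists (Sub ([set e; f], v) Pa : line_edge); rewrite ?inE.
move=> a b; rewrite !inE => /eqP Ea /eqP Eb Eab; apply: val_inj.
rewrite (surjective_pairing (val a)) (surjective_pairing (val b)) Eab.
by congr pair; rewrite -/(line_ends a) -/(line_ends b) [LHS]Ea [RHS]Eb.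
Qed.

Lemma edges_joining_line_loopless (e : mvert line_multigraph) :
  edges_joining e e = set0.
Proof.
apply/setP=> a; rewrite !inE; apply/negP => /eqP Ea.
by have := card_line_ends a; rewrite [line_ends a]Ea setUid cards1.
Qed.

End LineMultigraph.

(* Main.v *)
(* For a multigraph or hypergraph, a path from x to y exists as soon as x and y
   are related by the reflexive transitive closure of adjacency, so connectedness
   can be tested on walks. Walks transfer between H and its line multigraph
   through incidence, in a symmetric way: two vertices of one hyperedge are
   adjacent in H, two hyperedges through one vertex are equal or adjacent in the
   line multigraph, and adjacent objects of one kind share an incident object of
   the other kind. *)
Require Import Defs.
From mathcomp Require Import all_boot.

Set Implicit Arguments.
Unset Strict Implicit.
Unset Printing Implicit Defensive.

Section Adjacency.

Variables (V E : finType) (ends : E -> {set V}).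

Definition adjacent : rel V :=
  fun x y => [exists a, (x \in ends a) && (y \in ends a)].

Lemma is_path_catr x y p q :
  is_path ends x y (p ++ q) -> is_path ends (last x (unzip2 p)) y q.
Proof.
elim: p x => [|[a z] p IHp] //= x /and4P[/and3P[_ _ alt] lst].
by case/andP=> _ uV /andP[_ uE]; apply: IHp; apply/and4P.
Qed.

Lemma is_path_suffix x y z p :
  is_path ends x y p -> z \in x :: unzip2 p -> exists q, is_path ends z y q.
Proof.
move=> pth; rewrite inE => /predU1P[->|]; first by exists p.
case/mapP=> -[a w] /path.splitPr aw_p /= ->.
case: aw_p pth => p1 p2; rewrite -cat_rcons => /is_path_catr.
by rewrite /unzip2 map_rcons last_rcons /=; exists p2.
Qed.

(* If the new edge [a] already occurs in the path from [y], jump from [x]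
   directly to the end of its occurrence. *)
Lemma is_path_step x y z a p : x \in ends a -> y \in ends a ->
  is_path ends y z p -> exists q, is_path ends x z q.
Proof.
(* If [x] already lies on the path, prepending it would repeat a vertex, so the path is cut at [x]
   instead. *)
move=> xa ya pth; have [xp|xp] := boolP (x \in y :: unzip2 p).
  exact: is_path_suffix pth xp.
have [|ap] := boolP (a \in unzip1 p); last first.
  exists ((a, y) :: p); case/and4P: pth => alt lst uV uE.
  by apply/and4P; split; rewrite //= ?xa ?ya ?ap //; apply/andP.
case/mapP=> -[b w] /path.splitPr bw_p /= Eab; subst b.
case: bw_p pth xp => p1 p2 /is_path_catr /and4P[alt lst uV uE] xp.
case/and3P: alt => _ wa alt; exists ((a, w) :: p2).
apply/and4P; split=> //=; first by rewrite xa wa.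
case/andP: uV => _ ->; rewrite andbT.
by apply: contra xp; rewrite /unzip2 map_cat !inE mem_cat /= inE => ->; rewrite !orbT.
Qed.

Lemma connect_is_path x y :
  connect adjacent x y <-> exists p, is_path ends x y p.
Proof.
split=> [/connectP[s] | [p /and4P[alt /eqP <- _ _]]].
  elim: s x => [|z s IHs] x /=.
    by move=> _ ->; exists [::]; rewrite /is_path /= eqxx.
  case/andP=> /existsP[a /andP[xa za]] /IHs{}IHs /IHs[p].
  exact: is_path_step xa za.
elim: p x alt => [|[a z] p IHp] x //= /and3P[xa za /IHp].
by apply: connect_trans; apply: connect1; apply/existsP; exists a; rewrite xa.
Qed.

Lemma connected_byP :
  connected_by ends <-> forall x y, connect adjacent x y.
Proof. by split=> c x y; apply/connect_is_path. Qed.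

End Adjacency.

(** Objects shared at successive steps of an [r]-walk are both incident to the point between those
    steps, so [s] links them. Keeping [u] arbitrary in the induction lets each shared object start
    the rest of the walk. *)
Lemma connect_transfer (T U : finType) (r : rel T) (s : rel U)
    (inc : T -> U -> bool) :
  (forall x u v, inc x u -> inc x v -> connect s u v) ->
  (forall x y, r x y -> exists2 u, inc x u & inc y u) ->
  forall x y u v, connect r x y -> inc x u -> inc y v -> connect s u v.
Proof.
move=> incs rinc x y u v /connectP[p].
elim: p x u => [|z p IHp] x u /=; first by move=> _ ->; apply: incs.
case/andP=> /rinc[w xw zw] pz Ey xu yv.
exact: connect_trans (incs _ _ _ xu xw) (IHp _ _ pz Ey zw yv).
Qed.

Section LineAdjacency.

Variable H : hypergraph.

Let hadj := adjacent (fun e : hedge H => val e).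
Let ladj := adjacent (@line_ends H).

Lemma line_adjacentP (e f : hedge H) v :
  e != f -> v \in val e -> v \in val f -> ladj e f.
Proof.
move=> nef ve vf.
have Pa : (#|([set e; f], v).1| == 2) &&
    [forall g in ([set e; f], v).1, ([set e; f], v).2 \in val g].
  rewrite /= cards2 nef /=; apply/forall_inP => g.
  by rewrite !inE => /orP[] /eqP ->.
apply/existsP; exists (Sub ([set e; f], v) Pa : line_edge H).
by rewrite /line_ends SubK !inE !eqxx orbT.
Qed.

Lemma line_connected_hconnected (e f : hedge H) x y :
  connect ladj e f -> x \in val e -> y \in val f -> connect hadj x y.
Proof.
apply: (connect_transfer (inc := fun (g : hedge H) z => z \in val g)).
  by move=> g u v ug vg; apply: connect1; apply/existsP; exists g; rewrite ug.
move=> g h /existsP[a /andP[ga ha]].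
(* The shared vertex is the one recorded in the line edge [a]. *)
by case/andP: (valP a) => _ /forall_inP va; exists (val a).2; apply: va.
Qed.

Lemma hconnected_line_connected (e f : hedge H) x y :
  connect hadj x y -> x \in val e -> y \in val f -> connect ladj e f.
Proof.
apply: (connect_transfer (inc := fun z (g : hedge H) => z \in val g)).
  (* A line edge has two distinct ends, so equal hyperedges are linked by the empty walk. *)
  move=> z g h zg zh; have [->|ngh] := eqVneq g h; first exact: connect0.
  exact/connect1/(line_adjacentP ngh zg).
by move=> z w /existsP[g /andP[zg wg]]; exists g.
Qed.

(** Supplies a vertex from which a walk in [H] can start or end when two hyperedges are to be
    linked. *)
Lemma hedge_neq0 (e : hedge H) : exists x, x \in val e.
Proof.
apply/set0Pn; apply: contraNneq (hedges_neq0 H) => <-; exact: valP e.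
Qed.

(** The witness is obtained constructively: existence over the finite set of hyperedges is
    decidable. *)
Lemma not_isolated_hedge (x : hvert H) :
  ~ isolated x -> exists e : hedge H, x \in val e.
Proof.
move=> nix; have [/exists_inP[e eH xe]|/exists_inPn nx] :=
  boolP [exists e in hedges H, x \in e]; first by exists (Sub e eH).
by case: nix.
Qed.

End LineAdjacency.

Theorem lemma2p6 (H : hypergraph) (simpleH : simple H)
    (no_isolated : forall v : hvert H, ~ isolated v) :
  mconnected (line_multigraph H) <-> hconnected H.
Proof.
split=> /connected_byP c; apply/connected_byP.
  move=> x y; have [e xe] := not_isolated_hedge (no_isolated x).
  have [f yf] := not_isolated_hedge (no_isolated y).
  exact: line_connected_hconnected (c e f) xe yf.
move=> e f; have [[x xe] [y yf]] := (hedge_neq0 e, hedge_neq0 f).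
exact: hconnected_line_connected (c x y) xe yf.
Qed.
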